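(* Let $n\ge1$, $\theta^i\in\mathbb{R}$, $\sigma^i>0$ and $\tau^i=1/(\sigma^i)^2$ for $i=1,\dots,n$, and let $S_k^i\sim\mathcal{N}(\theta^i,(\sigma^i)^2)$, $k\ge1$, be the observations of agent $i$. Let $\{\mathcal{G}_k\}_{k\ge 0}$ be a $B$-strongly connected sequence of directed graphs on $\{1,\dots,n\}$ with associated weight matrices $A_k$, and let $\theta_k^i$ be generated, from initial values $\theta_0^i\in\mathbb{R}$ and $\tau_0^i=\tau^i$, by $$\tau_{k+1}^i=\sum_{j=1}^n[A_k]_{ij}\tau_k^j+\tau^i,\qquad \theta_{k+1}^i=\frac{\sum_{j=1}^n[A_k]_{ij}\tau_k^j\theta_k^j+S_{k+1}^i\tau^i}{\tau_{k+1}^i},\qquad k\ge 0.$$ Let $$\theta^*=\frac{\sum_{i=1}^n\theta^i/(\sigma^i)^2}{\sum_{j=1}^n1/(\sigma^j)^2}.$$ Then for every $i$ the sequence $\mathbb{E}[\theta_k^i]$ converges to $\theta^*$ as $k\to\infty$ with rate $O(1/k)$: there is a constant $K$, depending on the graph sequence (network topology and number of agents), the precisions $\tau^1,\dots,\tau^n$, the means $\theta^1,\dots,\theta^n$ and the initial values $\theta_0^1,\dots,\theta_0^n$, but not on $k$, such that $$\left|\mathbb{E}[\theta_k^i]-\theta^*\right|\le \frac{K}{k}\qquad\text{for all }k\ge1\text{ and all }i.$$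
   Context: Superscripts index agents $i,j\in\{1,\dots,n\}$ and subscripts $k$ index time; $(\sigma^i)^2$ is the square of the number $\sigma^i$ attached to agent $i$. $\mathcal{N}(\theta,\sigma^2)$ denotes the Gaussian distribution with mean $\theta$ and variance $\sigma^2$. The initial values $\theta_0^i$ are deterministic. Communication: $\mathcal{G}_k=(\{1,\dots,n\},E_k)$ is the directed graph at time $k\ge0$, where $(j,i)\in E_k$ with $j\neq i$ means agent $j$ can communicate with agent $i$ at time $k$. $d_k^j$ is the out-degree of node $j$ at time $k$ (the number of $i\neq j$ with $(j,i)\in E_k$). The matrix $A_k$ is defined by $[A_k]_{ij}=\frac{1}{d_k^j+1}$ if $(j,i)\in E_k$ or $i=j$, and $[A_k]_{ij}=0$ otherwise; thus $A_k$ is column stochastic with positive diagonal entries. The graph sequence is called $B$-strongly connected if $B\ge1$ is an integer such that the graph $\left(\{1,\dots,n\},\bigcup_{t=kB}^{(k+1)B-1}E_t\right)$ is strongly connected for every $k\ge0$. *)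

(* Defs.v *)
From HB Require Import structures.
From mathcomp Require Import all_boot all_order all_algebra.
From mathcomp Require Import all_classical all_reals all_analysis.

Set Implicit Arguments.
Unset Strict Implicit.
Unset Printing Implicit Defensive.

Import Order.TTheory GRing.Theory Num.Theory.
Import numFieldNormedType.Exports.

Local Open Scope classical_set_scope.
Local Open Scope ring_scope.

(* A sequence of directed graphs is [E : nat -> rel 'I_n], where [E k j i] means
   that agent j can communicate with agent i at time k.  Values of [E k] on the
   diagonal play no role. *)

Definition out_degree (n : nat) (e : rel 'I_n) (j : 'I_n) : nat :=
  #|[pred i | (i != j) && e j i]|.

Definition weight_matrix (R : realType) (n : nat) (e : rel 'I_n) : 'M[R]_n :=
  \matrix_(i, j) (if e j i || (i == j) then ((out_degree e j).+1)%:R^-1 else 0).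

Definition strongly_connected (n : nat) (e : rel 'I_n) : Prop :=
  forall i j : 'I_n, connect e i j.

Definition window_union (n : nat) (E : nat -> rel 'I_n) (B k : nat) : rel 'I_n :=
  [rel i j | [exists t : 'I_B, E (k * B + t)%N i j]].

Definition B_strongly_connected (n : nat) (E : nat -> rel 'I_n) (B : nat) : Prop :=
  (0 < B)%N /\ forall k : nat, strongly_connected (window_union E B k).

(* The law is compared on measurable sets only: a pushforward carries no
   information on the others.  [s] is the standard deviation. *)
Definition has_normal_law (R : realType) (d : measure_display)
    (T : measurableType d) (P : probability T R) (X : {RV P >-> R})
    (m s : R) : Prop :=
  forall A : set R, measurable A -> distribution P X A = normal_prob m s A.

Definition precision (R : realType) (n : nat) (sigma : 'I_n -> R) (i : 'I_n) : R :=
  1 / sigma i ^+ 2.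

Fixpoint tau_seq (R : realType) (n : nat) (E : nat -> rel 'I_n)
    (sigma : 'I_n -> R) (k : nat) (i : 'I_n) : R :=
  match k with
  | 0%N => precision sigma i
  | k'.+1 =>
      \sum_(j < n) weight_matrix R (E k') i j * tau_seq E sigma k' j
      + precision sigma i
  end.

(* The estimates as functions of the outcome [w]; [S k i] is the observation of
   agent i at time k, and [S 0] is never used. *)
Fixpoint theta_seq (R : realType) (n : nat) (E : nat -> rel 'I_n)
    (sigma theta0 : 'I_n -> R) (T : Type) (S : nat -> 'I_n -> T -> R)
    (k : nat) (i : 'I_n) (w : T) : R :=
  match k with
  | 0%N => theta0 i
  | k'.+1 =>
      (\sum_(j < n) weight_matrix R (E k') i j * tau_seq E sigma k' j
                    * theta_seq E sigma theta0 S k' j w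
       + S k'.+1 i w * precision sigma i)
      / tau_seq E sigma k'.+1 i
  end.

Definition theta_star (R : realType) (n : nat) (theta sigma : 'I_n -> R) : R :=
  (\sum_(i < n) theta i / sigma i ^+ 2) / (\sum_(j < n) 1 / sigma j ^+ 2).

(* Main.v *)
Require Import Defs.
From HB Require Import structures.
From mathcomp Require Import all_boot all_order all_algebra.
From mathcomp Require Import all_classical all_reals all_analysis.
From mathcomp Require Import measurable_realfun.
From mathcomp Require Import zify ring lra.

Set Implicit Arguments.
Unset Strict Implicit.
Unset Printing Implicit Defensive.

Import Order.TTheory GRing.Theory Num.Theory.
Import numFieldNormedType.Exports.

Local Open Scope classical_set_scope.
Local Open Scope ring_scope.

(** Taking expectations in the recursion for theta shows that the means
    [mu_k^i] of the estimates follow the same recursion with every observation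
    replaced by its mean [theta^i].  The weighted errors
    [z_k^i = tau_k^i (mu_k^i - theta_star)] then satisfy
    [z_(k+1) = A_k z_k + v] with [v^i = tau^i (theta^i - theta_star)], and the
    definition of [theta_star] says precisely that the entries of [v] sum to zero.
    The rate follows from two facts: [z_k] stays bounded, and [tau_k^i] grows
    at least linearly in [k].

    Both facts come from one positivity property.  Every positive entry of
    [A_k] is at least [1/n].  The set of nodes reached from a given node, with
    waiting allowed, strictly grows over each window of length [B] until it is
    everything, so all entries of the product of [A_k] over at least [n]
    aligned windows, but at most [2 n B] steps, are at least
    [delta = n^(-2 n B)] ([transition_block_ge]).

    Boundedness ([affine_bounded]): a column-stochastic matrix [M] with entries
    at least [delta] satisfies
    [|M x|_1 <= (1 - n delta) |x|_1 + n delta |sum x|] ([l1_norm_contract]).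
    The sum of the entries of [z_k] does not depend on [k], so over blocks of
    length [n B] the l1 norm obeys an affine contraction and remains below its
    fixed point plus its initial value.

    Linear growth ([affine_linear_growth]): the total precision at time [k] is
    [k + 1] times the sum of the [tau^i], and one block later every agent holds
    at least the fraction [delta] of it.

    The mean of the normal law is obtained from its symmetry about [m]: the law
    is invariant under [x |-> 2 m - x], so [I = 2 m - I] for [I] its mean, as
    soon as the identity is integrable.  Integrability follows by bounding
    [|x - m|] times the density by a multiple of the density of a wider normal
    law. *)

(** * Means of normal random variables *)

(** The map [x |-> c - x], that is, the reflection about [c / 2]. *)
Definition reflect_about (R : realType) (c x : R) : R := c - x.

Lemma measurable_reflect_about (R : realType) (c : R) :
  measurable_fun [set: R] (reflect_about c).
Proof. exact: measurable_funB. Qed.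

Lemma lebesgue_measure_reflect (R : realType) (c : R) (A : set R) :
  measurable A ->
  pushforward lebesgue_measure (reflect_about c : _ -> measurableTypeR R) A =
  lebesgue_measure A.
Proof.
move=> mA; apply/esym.
apply: (@lebesgue_measure_unique R
  (pushforward lebesgue_measure (reflect_about c : _ -> measurableTypeR R))) => //=.
  exact: measurable_reflect_about.
move=> _ _ [[a b]] _ <-.
rewrite /pushforward/= (_ : _ @^-1` _ = `[(c - b)%R, (c - a)%R[%classic); last first.
  apply/seteqP; split => x/=; rewrite !in_itv/= /reflect_about => /andP[? ?];
    by apply/andP; split; lra.
rewrite !lebesgue_measure_itv/= !lte_fin ltrD2l ltrN2; case: ifP => // _.
by rewrite -!EFinB; congr EFin; ring.
Qed.

Lemma normal_prob_reflect (R : realType) (m s : R) (A : set R) :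
  s != 0 -> measurable A ->
  pushforward (normal_prob m s)
    (reflect_about (m + m) : _ -> measurableTypeR R) A = normal_prob m s A.
Proof.
move=> s0 mA; rewrite /pushforward /normal_prob.
pose phi : measurableTypeR R -> measurableTypeR R := reflect_about (m + m).
have mphi : measurable_fun setT phi by exact: measurable_reflect_about.
transitivity (\int[lebesgue_measure]_(x in phi @^-1` A) ((EFin \o normal_pdf m s) \o phi) x)%E.
  apply: eq_integral => x _ /=; congr EFin.
  rewrite !(normal_pdfE _ s0) /normal_fun /phi /reflect_about.
  have -> : m + m - x - m = - (x - m) by ring.
  by rewrite sqrrN; reflexivity.
rewrite -ge0_integral_pushforward//=.
- by apply: eq_measure_integral => B mB _; exact: lebesgue_measure_reflect.
- by apply/measurable_EFinP/measurable_funTS; exact: measurable_normal_pdf.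
- by move=> y _; rewrite lee_fin normal_pdf_ge0.
Qed.

(** The density of the normal law agrees almost everywhere with its
    Radon-Nikodym derivative, for which the change of variables is known. *)
Lemma ge0_integral_normal_prob (R : realType) (m s : R) (f : R -> \bar R) :
  measurable_fun setT f -> (forall x, 0 <= f x)%E ->
  (\int[normal_prob m s]_x f x = \int[lebesgue_measure]_x (f x * (normal_pdf m s x)%:E))%E.
Proof.
move=> mf f0; have dom := normal_prob_dominates m s.
rewrite -(Radon_Nikodym_SigmaFinite.change_of_variables dom)//.
have mpdf : measurable_fun setT (EFin \o normal_pdf m s).
  by apply/measurable_EFinP; exact: measurable_normal_pdf.
have mRN : measurable_fun setT
    (Radon_Nikodym_SigmaFinite.f (normal_prob m s) (@lebesgue_measure R)).
  exact: measurable_int (Radon_Nikodym_SigmaFinite.f_integrable dom).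
apply: ae_eq_integral => //.
- by apply: emeasurable_funM.
- by apply: emeasurable_funM.
apply: ae_eqe_mul2l; apply: integral_ae_eq => //.
- exact: Radon_Nikodym_SigmaFinite.f_integrable.
- by move=> A _ mA; rewrite -Radon_Nikodym_SigmaFinite.f_integral.
Qed.

(** With [t = x - m] and [u = t^2 / (4 s^2)], the ratio of the two densities is
    a constant times [exp (- u)], and [|t| <= s (1 + u) <= s exp u], the first
    inequality being that of arithmetic and geometric means. *)
Lemma normal_pdf_moment1 (R : realType) (m s x : R) : 0 < s ->
  `|x - m| * normal_pdf m s x <=
  s * normal_peak s / normal_peak (Num.sqrt 2 * s) * normal_pdf m (Num.sqrt 2 * s) x.
Proof.
move=> s0; have s20 : 0 < Num.sqrt 2 * s by rewrite mulr_gt0 ?sqrtr_gt0.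
rewrite !normal_pdfE ?gt_eqF//.
have p0 := normal_peak_gt0 (lt0r_neq0 s0); have q0 := normal_peak_gt0 (lt0r_neq0 s20).
rewrite [leRHS]mulrA divfK ?gt_eqF// mulrCA -mulrA [leRHS]mulrCA ler_pM2l//.
rewrite /normal_fun exprMn sqr_sqrtr//.
set t := x - m; set u := t ^+ 2 / (2 * s ^+ 2 *+ 2).
have -> : - t ^+ 2 / (s ^+ 2 *+ 2) = - u - u.
  by rewrite /u; field; rewrite gt_eqF.
rewrite mulNr -/u expRD mulrA ler_pM2r ?expR_gt0//.
rewrite expRN ler_pdivrMr ?expR_gt0//.
have := expR_ge1Dx u => hu.
apply: (@le_trans _ _ (s * (1 + u))); last by rewrite ler_pM2l.
(* The arithmetic-geometric gap, written as a square. *)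
have -> : s * (1 + u) = `|t| + (s - `|t| / 2) ^+ 2 / s.
  have -> : u = `|t| ^+ 2 / (2 * s ^+ 2 *+ 2) by rewrite /u real_normK ?num_real.
  by field; rewrite gt_eqF.
by rewrite lerDl divr_ge0 ?sqr_ge0 ?ltW.
Qed.

Lemma integrable_normal_id (R : realType) (m s : R) : 0 < s ->
  (normal_prob m s).-integrable [set: R] (EFin : R -> \bar R).
Proof.
move=> s0.
have mid : measurable_fun [set: R] (EFin : R -> \bar R).
  by apply/measurable_EFinP.
have mcent : measurable_fun [set: R] (fun x : R => (x - m)%:E).
  by apply/measurable_EFinP/measurable_funB.
have macent : measurable_fun [set: R] (fun x : R => `|(x - m)%:E|%E).
  exact: measurableT_comp.
have icst : (normal_prob m s).-integrable [set: R] (cst m%:E).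
  by apply: finite_measure_integrable_cst.
have icent : (normal_prob m s).-integrable [set: R] (fun x : R => (x - m)%:E).
  apply/integrableP; split; first exact: mcent.
  rewrite ge0_integral_normal_prob//.
  pose c := s * normal_peak s / normal_peak (Num.sqrt 2 * s).
  have c0 : 0 <= c by rewrite !mulr_ge0 ?invr_ge0 ?normal_peak_ge0 // ltW.
  apply: (@le_lt_trans _ _
     (\int[lebesgue_measure]_x (c%:E * (normal_pdf m (Num.sqrt 2 * s) x)%:E))%E).
    apply: ge0_le_integral => //=.
    - by move=> x _; rewrite mule_ge0// lee_fin normal_pdf_ge0.
    - apply: emeasurable_funM; first exact: macent.
      by apply/measurable_EFinP; exact: measurable_normal_pdf.
    - apply: emeasurable_funM => //=.
      by apply/measurable_EFinP; exact: measurable_normal_pdf.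
    - by move=> x _; rewrite -!EFinM lee_fin normal_pdf_moment1.
  rewrite ge0_integralZl//=.
  - by rewrite integral_normal_pdf mule1 ltry.
  - by apply/measurable_EFinP; exact: measurable_normal_pdf.
  - by move=> x _; rewrite lee_fin normal_pdf_ge0.
have := integrableD measurableT icent icst; apply: eq_integrable => // x _ /=.
by rewrite -EFinD subrK.
Qed.

Lemma normal_mean (R : realType) (m s : R) : 0 < s ->
  (\int[normal_prob m s]_x x%:E = m%:E)%E.
Proof.
move=> s0; have i1 := integrable_normal_id m s0.
set N := normal_prob m s in i1 *.
have i2 : N.-integrable [set: R] (cst (m + m)%:E).
  by apply: finite_measure_integrable_cst.
pose phi : measurableTypeR R -> measurableTypeR R := reflect_about (m + m).
have mphi : measurable_fun setT phi by exact: measurable_reflect_about.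
have i3 : N.-integrable [set: R] (EFin \o phi).
  by apply: (integrableB _ i2 i1).
have E1 : (\int[N]_x x%:E = \int[N]_x (phi x)%:E)%E.
  transitivity (\int[pushforward N phi]_x x%:E)%E.
    apply: eq_measure_integral => A mA _.
    exact: (esym (normal_prob_reflect m (lt0r_neq0 s0) mA)).
  by rewrite integral_pushforward//=; apply/measurable_EFinP.
have E2 : (\int[N]_x (phi x)%:E = (m + m)%:E - \int[N]_x x%:E)%E.
  have -> : (\int[N]_x (phi x)%:E = \int[N]_x (cst (m + m)%:E x - x%:E))%E.
    by apply: eq_integral => x _.
  by rewrite integralB//= integral_cst//= probability_setT mule1.
have := integrable_fin_num measurableT i1.
rewrite E2 in E1; move/fineK => fI; rewrite -fI in E1 *.
by move: E1; rewrite -EFinB => -[h]; congr EFin; lra.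
Qed.

(** [X] is integrable with expectation [e].  Integrability is part of the
    notion, which makes it stable under linear combinations. *)
Definition has_mean (R : realType) (d : measure_display) (T : measurableType d)
    (P : probability T R) (X : T -> R) (e : R) : Prop :=
  P.-integrable [set: T] (EFin \o X) /\ (\int[P]_w (X w)%:E = e%:E)%E.

Lemma has_mean_cst (R : realType) (d : measure_display) (T : measurableType d)
  (P : probability T R) (e : R) : has_mean P (cst e) e.
Proof.
split; first exact: finite_measure_integrable_cst.
by rewrite -[LHS]/(\int[P]_w (cst e%:E w))%E integral_cst//= probability_setT mule1.
Qed.

Lemma has_meanD (R : realType) (d : measure_display) (T : measurableType d)
    (P : probability T R) (X Y : T -> R) (a b : R) :
  has_mean P X a -> has_mean P Y b -> has_mean P (fun w => X w + Y w) (a + b).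
Proof.
move=> [iX EX] [iY EY]; split; first exact: (integrableD measurableT iX iY).
by rewrite (integralD measurableT iX iY) EX EY.
Qed.

Lemma has_meanZ (R : realType) (d : measure_display) (T : measurableType d)
    (P : probability T R) (X : T -> R) (c a : R) :
  has_mean P X a -> has_mean P (fun w => c * X w) (c * a).
Proof.
move=> [iX EX]; split; first exact: (integrableZl measurableT c iX).
by rewrite (integralZl measurableT iX) EX.
Qed.

Lemma has_mean_sum (R : realType) (d : measure_display) (T : measurableType d)
    (P : probability T R) (I : Type) (r : seq I) (X : I -> T -> R) (a : I -> R) :
  (forall j, has_mean P (X j) (a j)) ->
  has_mean P (fun w => \sum_(j <- r) X j w) (\sum_(j <- r) a j).
Proof.
move=> hX; elim: r => [|j r IHr].
  rewrite big_nil (_ : (fun _ => _) = cst 0); first exact: has_mean_cst.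
  by apply/funext => w; rewrite big_nil.
rewrite big_cons (_ : (fun _ => _) = fun w => X j w + \sum_(j <- r) X j w).
  exact: has_meanD.
by apply/funext => w; rewrite big_cons.
Qed.

Lemma has_normal_law_mean (R : realType) (d : measure_display)
    (T : measurableType d) (P : probability T R) (X : {RV P >-> R}) (m s : R) :
  0 < s -> has_normal_law X m s -> has_mean P X m.
Proof.
move=> s0 hX.
(* [normal_prob] lives on [measurableTypeR R], whose Borel sets are those of [R]
   but under another display; [Y] is [X] with that codomain. *)
pose Y : T -> measurableTypeR R := X.
have mY : measurable_fun setT Y.
  by move=> _ A mA; rewrite setTI; exact: (measurable_funPTI X mA).
have eqN f : (\int[pushforward P Y]_x f x = \int[normal_prob m s]_x f x)%E.
  apply: eq_measure_integral => A mA _; exact: hX mA.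
have iX : P.-integrable [set: T] (EFin \o X).
  apply/integrableP; split; first by apply/measurable_EFinP.
  have /integrableP[mid] := integrable_normal_id m s0.
  by rewrite -eqN ge0_integral_pushforward//; apply: measurableT_comp.
by split=> //; rewrite -(normal_mean m s0) -eqN integral_pushforward.
Qed.

(** * Column-stochastic matrices and the l1 norm *)

Definition col_stochastic (R : realType) (n : nat) (M : 'M[R]_n) : Prop :=
  (forall i j, 0 <= M i j) /\ (forall j, \sum_i M i j = 1).

Definition l1_norm (R : realType) (n : nat) (x : 'cV[R]_n) : R := \sum_i `|x i 0|.

(** The sum of the entries, preserved by column-stochastic matrices. *)
Definition total (R : realType) (n : nat) (x : 'cV[R]_n) : R := \sum_i x i 0.

Lemma l1_norm_ge0 (R : realType) (n : nat) (x : 'cV[R]_n) : 0 <= l1_norm x.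
Proof. exact: sumr_ge0. Qed.

Lemma le_l1_norm (R : realType) (n : nat) (x : 'cV[R]_n) (i : 'I_n) :
  `|x i 0| <= l1_norm x.
Proof. by rewrite /l1_norm (bigD1 i)//= lerDl sumr_ge0. Qed.

Lemma ler_l1_normD (R : realType) (n : nat) (x y : 'cV[R]_n) :
  l1_norm (x + y) <= l1_norm x + l1_norm y.
Proof.
by rewrite /l1_norm -big_split/=; apply: ler_sum => i _; rewrite mxE ler_normD.
Qed.

Lemma totalD (R : realType) (n : nat) (x y : 'cV[R]_n) :
  total (x + y) = total x + total y.
Proof.
by rewrite /total -big_split/=; apply: eq_bigr => i _; rewrite mxE.
Qed.

Lemma col_stochastic1 (R : realType) (n : nat) : col_stochastic (1%:M : 'M[R]_n).
Proof.
split=> [i j|j]; first by rewrite mxE ler0n.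
rewrite (bigD1 j)//= big1 ?addr0 ?mxE ?eqxx// => i ij.
by rewrite mxE (negbTE ij).
Qed.

Lemma total_mulmx (R : realType) (n : nat) (M : 'M[R]_n) (x : 'cV[R]_n) :
  col_stochastic M -> total (M *m x) = total x.
Proof.
move=> [_ M1]; rewrite /total; under eq_bigr do rewrite mxE.
rewrite exchange_big/=; apply: eq_bigr => j _.
by rewrite -mulr_suml M1 mul1r.
Qed.

Lemma col_stochasticM (R : realType) (n : nat) (M N : 'M[R]_n) :
  col_stochastic M -> col_stochastic N -> col_stochastic (M *m N).
Proof.
move=> M1 N1; split=> [i j|j].
  by rewrite mxE sumr_ge0// => k _; rewrite mulr_ge0 ?M1.1 ?N1.1.
have := total_mulmx (col j N) M1; rewrite /total.
under [in RHS]eq_bigr do rewrite mxE.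
rewrite N1.2 => <-; apply: eq_bigr => i _; rewrite !mxE.
by apply: eq_bigr => k _; rewrite mxE.
Qed.

(** A Doeblin-type contraction, without assuming that the entries of [x] sum to
    zero: [delta] times the all-ones matrix is split off [M], and only that part
    sees the total. *)
Lemma l1_norm_contract (R : realType) (n : nat) (M : 'M[R]_n) (delta : R)
    (x : 'cV[R]_n) :
  col_stochastic M -> 0 <= delta -> (forall i j, delta <= M i j) ->
  l1_norm (M *m x) <= (1 - n%:R * delta) * l1_norm x + n%:R * delta * `|total x|.
Proof.
move=> [_ M1] d0 dM.
have row i : `|(M *m x) i 0| <=
    \sum_j (M i j - delta) * `|x j 0| + delta * `|total x|.
  have -> : (M *m x) i 0 = \sum_j (M i j - delta) * x j 0 + delta * total x.
    rewrite mxE /total mulr_sumr -big_split/=; apply: eq_bigr => j _.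
    by rewrite mulrBl subrK.
  apply: le_trans (ler_normD _ _) _; rewrite normrM (ger0_norm d0) lerD2r.
  apply: le_trans (ler_norm_sum _ _ _) _; apply: ler_sum => j _.
  by rewrite normrM ger0_norm// subr_ge0.
apply: le_trans (ler_sum _ (fun i _ => row i)) _.
rewrite big_split/= sumr_const card_ord.
rewrite -[X in _ + X <= _]mulr_natl mulrA lerD2r.
rewrite exchange_big/= mulr_sumr; apply: ler_sum => j _.
rewrite -mulr_suml ler_wpM2r// sumrB M1 sumr_const card_ord.
by rewrite mulr_natl.
Qed.

Lemma l1_norm_mulmx (R : realType) (n : nat) (M : 'M[R]_n) (x : 'cV[R]_n) :
  col_stochastic M -> l1_norm (M *m x) <= l1_norm x.
Proof.
move=> M1; have := l1_norm_contract x M1 (lexx 0) M1.1.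
by rewrite mulr0 subr0 mul0r addr0 mul1r.
Qed.

(** * Products of weight matrices *)

Lemma out_degree_lt (n : nat) (e : rel 'I_n) (j : 'I_n) : (out_degree e j < n)%N.
Proof.
rewrite -[X in (_ < X)%N]card_ord; apply: proper_card; apply/properP; split.
  by apply/fintype.subsetP.
by exists j; rewrite // inE eqxx.
Qed.

Lemma weight_matrix_ge0 (R : realType) (n : nat) (e : rel 'I_n) (i j : 'I_n) :
  0 <= weight_matrix R e i j.
Proof. by rewrite mxE; case: ifP => // _; rewrite invr_ge0 ler0n. Qed.

Lemma weight_matrix_ge (R : realType) (n : nat) (e : rel 'I_n) (i j : 'I_n) :
  e j i || (i == j) -> n%:R^-1 <= weight_matrix R e i j.
Proof.
move=> eji; rewrite mxE eji lef_pV2 ?posrE ?ltr0n//; last exact: leq_ltn_trans (ltn_ord j).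
by rewrite ler_nat out_degree_lt.
Qed.

Lemma weight_matrix_col_stochastic (R : realType) (n : nat) (e : rel 'I_n) :
  col_stochastic (weight_matrix R e).
Proof.
split=> [i j|j]; first exact: weight_matrix_ge0.
under eq_bigr do rewrite mxE.
rewrite -big_mkcond/= sumr_const -[_ *+ _]mulr_natr.
have -> : #|[pred i | e j i || (i == j)]| = (out_degree e j).+1.
  rewrite (cardD1 j) inE eqxx orbT add1n; congr _.+1.
  by apply: eq_card => i; rewrite !inE; case: (i == j); rewrite ?orbF ?andbF.
by rewrite mulVf// pnatr_eq0.
Qed.

(** The product [A_(s+m-1) ... A_s] of the [m] weight matrices from time [s]. *)
Fixpoint transition (R : realType) (n : nat) (E : nat -> rel 'I_n) (s m : nat)
    : 'M[R]_n :=
  if m is m'.+1 then weight_matrix R (E (s + m')%N) *m transition R E s m'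
  else 1%:M.

Lemma transition_col_stochastic (R : realType) (n : nat) (E : nat -> rel 'I_n)
    (s m : nat) : col_stochastic (transition R E s m).
Proof.
elim: m => [|m IHm] /=; first exact: col_stochastic1.
exact: col_stochasticM (weight_matrix_col_stochastic R _) IHm.
Qed.

(** The nodes that information leaving [j] at time [s] can have reached after
    [m] steps, where at each step it may also stay where it is. *)
Fixpoint reached (n : nat) (E : nat -> rel 'I_n) (s : nat) (j : 'I_n) (m : nat)
    : {set 'I_n} :=
  if m is m'.+1 then
    [set i | (i \in reached E s j m')
       || [exists l, (l \in reached E s j m') && E (s + m')%N l i]]
  else [set j].

Lemma transition_ge (R : realType) (n : nat) (E : nat -> rel 'I_n) (s m : nat)
    (i j : 'I_n) :
  i \in reached E s j m -> n%:R^-1 ^+ m <= transition R E s m i j.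
Proof.
elim: m i => [|m IHm] i /=.
  by rewrite inE => /eqP ->; rewrite mxE eqxx expr0.
move=> hi.
have [l [lm eli]] : exists l, l \in reached E s j m /\ E (s + m)%N l i || (i == l).
  move: hi; rewrite inE => /orP[im|/existsP[l /andP[lm eli]]].
    by exists i; rewrite eqxx orbT.
  by exists l; rewrite eli.
rewrite mxE (bigD1 l)//= -[leLHS]addr0 lerD//.
  by rewrite exprS ler_pM ?IHm ?weight_matrix_ge ?exprn_ge0 ?invr_ge0.
apply: sumr_ge0 => k _; rewrite mulr_ge0 ?weight_matrix_ge0//.
exact: (transition_col_stochastic R E s m).1.
Qed.

Lemma reached_mono (n : nat) (E : nat -> rel 'I_n) (s : nat) (j : 'I_n)
    (m p : nat) : (m <= p)%N -> reached E s j m \subset reached E s j p.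
Proof.
move=> /subnK <-; elim: (p - m)%N => [|q IHq]; first exact: subxx.
apply: fintype.subset_trans IHq _; rewrite addSn /=.
by apply/fintype.subsetP => i iq; rewrite inE iq.
Qed.

Lemma mem_reached (n : nat) (E : nat -> rel 'I_n) (s : nat) (j : 'I_n)
    (m : nat) : j \in reached E s j m.
Proof. by apply: (fintype.subsetP (reached_mono E s j (leq0n m))); rewrite inE. Qed.

(** If nothing new is reached during a whole window, the reached set is closed
    under the edges of the window, hence is everything by strong
    connectivity. *)
Lemma reached_stable (n : nat) (E : nat -> rel 'I_n) (B k m s : nat) (j : 'I_n) :
  strongly_connected (window_union E B k) -> (s + m = k * B)%N ->
  reached E s j (m + B) = reached E s j m -> reached E s j m = [set: 'I_n]%SET.
Proof.
move=> sc smk stable.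
have closed i l : window_union E B k i l ->
    i \in reached E s j m -> l \in reached E s j m.
  move=> /existsP[t il] im; rewrite -stable.
  apply: (fintype.subsetP (reached_mono E s j (_ : (m + t).+1 <= m + B)%N)).
    by rewrite -addnS leq_add2l.
  rewrite /= inE; apply/orP; right; apply/existsP; exists i.
  by rewrite addnA smk il (fintype.subsetP (reached_mono E s j (leq_addr t m))).
have closed_path p y : path (window_union E B k) y p ->
    y \in reached E s j m -> last y p \in reached E s j m.
  elim: p y => [//|l p IHp] y /= /andP[yl pl] ym.
  exact: IHp pl (closed _ _ yl ym).
apply/finset.setP => i; rewrite inE; have /connectP[p pathp ->] := sc j i.
exact: closed_path pathp (mem_reached E s j m).
Qed.

Lemma reached_all (n : nat) (E : nat -> rel 'I_n) (B k m : nat) (j : 'I_n) :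
  B_strongly_connected E B -> (n * B <= m)%N ->
  reached E (k * B) j m = [set: 'I_n]%SET.
Proof.
move=> [_ sc] nBm; set U := reached E (k * B) j.
(* Each of the first [n - 1] windows adds a node, unless all are reached. *)
have grow r : (r < n)%N -> (r < #|U (r * B)%N|)%N \/ U (r * B)%N = [set: 'I_n]%SET.
  elim: r => [|r IHr] rn; first by left; rewrite /U mul0n cards1.
  have sub : U (r * B)%N \subset U (r.+1 * B)%N.
    by apply: reached_mono; rewrite leq_mul2r leqnSn orbT.
  have [cardr|full] := IHr (ltnW rn); last first.
    by right; apply/eqP; rewrite finset.eqEsubset finset.subsetT -full sub.
  have [eqU|neqU] := eqVneq (U (r.+1 * B)%N) (U (r * B)%N).
    right; rewrite eqU; apply: (reached_stable (sc (k + r)%N)).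
      by rewrite mulnDl.
    by rewrite addnC -mulSn.
  left; apply: leq_ltn_trans cardr _; apply: proper_card.
  by rewrite finset.properEneq eq_sym neqU sub.
have n0 : (0 < n)%N by apply: leq_ltn_trans (ltn_ord j).
have n1 : (n.-1 < n)%N by rewrite prednK.
apply/eqP; rewrite finset.eqEsubset finset.subsetT.
apply: fintype.subset_trans (_ : U (n.-1 * B)%N \subset _); last first.
  by apply: reached_mono; apply: leq_trans nBm; rewrite leq_mul2r leq_pred orbT.
case: (grow n.-1 n1) => [|->//]; rewrite prednK// => cn.
have /eqP -> // : U (n.-1 * B)%N == [set: 'I_n]%SET.
by rewrite eqEcard finset.subsetT cardsT card_ord.
Qed.

(** The upper bound on [m] makes the bound on the entries independent of
    [m]. *)
Lemma transition_block_ge (R : realType) (n : nat) (E : nat -> rel 'I_n)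
    (B k m : nat) (i j : 'I_n) :
  B_strongly_connected E B -> (n * B <= m <= 2 * (n * B))%N ->
  (n%:R^-1 : R) ^+ (2 * (n * B)) <= transition R E (k * (n * B)) m i j.
Proof.
move=> hE /andP[lm um].
have n0 : (0 < n)%N by apply: leq_ltn_trans (ltn_ord j).
apply: le_trans (transition_ge R (_ : i \in reached E (k * (n * B)) j m)).
  by rewrite ler_wiXn2l ?invr_ge0 ?ler0n// invf_le1 ?ltr0n// ler1n.
by rewrite mulnA (reached_all (k * n) j hE lm) inE.
Qed.

(** * Affine recursions driven by weight matrices *)

Lemma affine_l1_norm (R : realType) (n : nat) (E : nat -> rel 'I_n)
    (x : nat -> 'cV[R]_n) (v : 'cV[R]_n) (s m : nat) :
  (forall k, x k.+1 = weight_matrix R (E k) *m x k + v) ->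
  l1_norm (x (s + m)%N) <= l1_norm (transition R E s m *m x s) + m%:R * l1_norm v.
Proof.
move=> xS; apply: (@le_trans _ _ (l1_norm (transition R E s m *m x s) +
  l1_norm (x (s + m)%N - transition R E s m *m x s))).
  by rewrite -[in leLHS](subrK (transition R E s m *m x s) (x (s + m)%N)) addrC
    ler_l1_normD.
rewrite lerD2l; elim: m => [|m IHm].
  by rewrite addn0 /= mul1mx subrr mul0r /l1_norm big1// => i _; rewrite mxE normr0.
rewrite addnS xS /= -mulmxA addrAC -mulmxBr.
apply: le_trans (ler_l1_normD _ _) _.
rewrite -natr1 mulrDl mul1r lerD2r; apply: le_trans _ IHm.
exact/l1_norm_mulmx/weight_matrix_col_stochastic.
Qed.

Lemma affine_ge (R : realType) (n : nat) (E : nat -> rel 'I_n)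
    (x : nat -> 'cV[R]_n) (v : 'cV[R]_n) (s m : nat) (i : 'I_n) :
  (forall k, x k.+1 = weight_matrix R (E k) *m x k + v) ->
  (forall i, 0 <= v i 0) ->
  (transition R E s m *m x s) i 0 <= x (s + m)%N i 0.
Proof.
move=> xS v0; elim: m i => [|m IHm] i; first by rewrite addn0 /= mul1mx.
rewrite addnS xS /= -mulmxA mxE [leRHS]mxE -[leLHS]addr0 lerD// [leRHS]mxE.
by apply: ler_sum => j _; rewrite ler_wpM2l ?weight_matrix_ge0.
Qed.

Lemma affine_total (R : realType) (n : nat) (E : nat -> rel 'I_n)
    (x : nat -> 'cV[R]_n) (v : 'cV[R]_n) (k : nat) :
  (forall k, x k.+1 = weight_matrix R (E k) *m x k + v) ->
  total (x k) = total (x 0%N) + k%:R * total v.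
Proof.
move=> xS; elim: k => [|k IHk]; first by rewrite mul0r addr0.
rewrite xS totalD total_mulmx ?IHk; last exact: weight_matrix_col_stochastic.
by rewrite -natr1 mulrDl mul1r addrA.
Qed.

(** Without total drift, an affine recursion stays bounded in l1 norm. *)
Lemma affine_bounded (R : realType) (n : nat) (E : nat -> rel 'I_n) (B : nat)
    (x : nat -> 'cV[R]_n) (v : 'cV[R]_n) :
  B_strongly_connected E B ->
  (forall k, x k.+1 = weight_matrix R (E k) *m x k + v) -> total v = 0 ->
  exists C, forall k, l1_norm (x k) <= C.
Proof.
move=> hE xS v0; have [n0|n_gt0] := posnP n.
  by exists 0 => k; rewrite /l1_norm big1// => i _; have := ltn_ord i; rewrite {2}n0.
pose L := (n * B)%N; pose delta : R := n%:R^-1 ^+ (2 * L).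
have L0 : (0 < L)%N by rewrite muln_gt0 n_gt0 hE.1.
have d0 : 0 < delta by rewrite exprn_gt0// invr_gt0 ltr0n.
have nd0 : 0 < n%:R * delta by rewrite mulr_gt0 ?ltr0n.
have nd1 : n%:R * delta <= 1.
  rewrite -ler_pdivlMl ?ltr0n// mulr1 -[leRHS]expr1 ler_wiXn2l ?invr_ge0//.
    by rewrite invf_le1 ?ltr0n// ler1n.
  by rewrite muln_gt0.
have tot k : total (x k) = total (x 0%N) by rewrite (affine_total k xS) v0 mulr0 addr0.
(* The last two terms form the fixed point of the block inequality
   [a |-> (1 - n delta) a + n delta |total x_0| + L |v|]. *)
pose C0 := l1_norm (x 0%N) + `|total (x 0%N)| + L%:R * l1_norm v / (n%:R * delta).
have hq : 0 <= L%:R * l1_norm v / (n%:R * delta).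
  apply: divr_ge0; last exact: ltW.
  by apply: mulr_ge0; [exact: ler0n | exact: l1_norm_ge0].
have block m : l1_norm (x (m * L)%N) <= C0.
  elim: m => [|m IHm]; first by rewrite mul0n /C0 -addrA lerDl addr_ge0.
  rewrite mulSn addnC; apply: le_trans (affine_l1_norm (m * L) L xS) _.
  have dM i j : delta <= transition R E (m * L) L i j.
    by apply: transition_block_ge => //; rewrite leqnn mul2n -addnn leq_addr.
  have := l1_norm_contract (x (m * L)%N)
    (transition_col_stochastic R E (m * L) L) (ltW d0) dM.
  rewrite tot => contr; apply: le_trans (lerD contr (lexx _)) _.
  apply: (@le_trans _ _ ((1 - n%:R * delta) * C0 +
    n%:R * delta * `|total (x 0%N)| + L%:R * l1_norm v)).
    by rewrite !lerD2r ler_wpM2l// subr_ge0.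
  have -> : L%:R * l1_norm v = n%:R * delta * (L%:R * l1_norm v / (n%:R * delta)).
    by rewrite [RHS]mulrC divfK// gt_eqF.
  have : 0 <= n%:R * delta * l1_norm (x 0%N) by rewrite mulr_ge0 ?l1_norm_ge0 ?ltW.
  rewrite /C0; lra.
exists (C0 + L%:R * l1_norm v) => k; rewrite (divn_eq k L).
apply: le_trans (affine_l1_norm _ _ xS) _; apply: lerD.
  by apply: le_trans (block (k %/ L)%N); exact/l1_norm_mulmx/transition_col_stochastic.
by rewrite ler_wpM2r ?l1_norm_ge0// ler_nat ltnW// ltn_pmod.
Qed.

(** With a positive drift, every coordinate receives a fixed fraction of the
    linearly growing total.  The hypothesis on [x 0] gives a positive lower
    bound at early times as well. *)
Lemma affine_linear_growth (R : realType) (n : nat) (E : nat -> rel 'I_n)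
    (B : nat) (x : nat -> 'cV[R]_n) (v : 'cV[R]_n) (i : 'I_n) :
  B_strongly_connected E B ->
  (forall k, x k.+1 = weight_matrix R (E k) *m x k + v) ->
  (forall j, 0 < v j 0) -> (forall j, v j 0 <= x 0%N j 0) ->
  exists2 c, 0 < c & forall k, c * k%:R <= x k i 0.
Proof.
move=> hE xS v0 x0; have n_gt0 : (0 < n)%N by apply: leq_ltn_trans (ltn_ord i).
have v0' j : 0 <= v j 0 by exact: ltW.
have xge0 k j : 0 <= x k j 0.
  case: k => [|k]; first exact: le_trans (x0 j).
  elim: k j => [|k IHk] j; rewrite xS mxE addr_ge0// mxE sumr_ge0// => l _;
    rewrite mulr_ge0 ?weight_matrix_ge0//.
  exact: le_trans (x0 l).
have xgev k j : v j 0 <= x k j 0.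
  case: k => [//|k]; rewrite xS mxE lerDr mxE sumr_ge0// => l _.
  by rewrite mulr_ge0 ?weight_matrix_ge0.
pose L := (n * B)%N; pose delta : R := n%:R^-1 ^+ (2 * L).
have L0 : (0 < L)%N by rewrite muln_gt0 n_gt0 hE.1.
have d0 : 0 < delta by rewrite exprn_gt0// invr_gt0 ltr0n.
have tv : v i 0 <= total v by rewrite /total (bigD1 i)//= lerDl sumr_ge0.
have tv0 : 0 < total v by exact: lt_le_trans tv.
have tx s : s%:R * total v <= total (x s).
  rewrite (affine_total s xS) lerDr /total sumr_ge0 // => j _; exact: xge0.
have late s m : (L <= m <= 2 * L)%N ->
    delta * (s * L)%:R * total v <= x (s * L + m)%N i 0.
  move=> hm; apply: le_trans (affine_ge _ _ _ xS v0').
  rewrite -mulrA; apply: (@le_trans _ _ (delta * total (x (s * L)%N))).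
    by rewrite ler_pM2l.
  rewrite /total mulr_sumr mxE; apply: ler_sum => j _.
  by rewrite ler_wpM2r// transition_block_ge.
pose a := Num.min (v i 0) (delta * total v).
have a0 : 0 < a by rewrite lt_min v0 mulr_gt0.
have L3 : 0 < (3 * L)%:R :> R by rewrite ltr0n muln_gt0.
exists (a / (3 * L)%:R); first exact: divr_gt0.
move=> k; rewrite mulrAC ler_pdivrMr//.
(* Before [3 L] the bound [v i 0] suffices; later, [k] is reached from the start
   of the block preceding its own, between [L] and [2 L] steps earlier. *)
have [kL|kL] := ltnP k (3 * L).
  apply: ler_pM => //.
  - exact: ltW.
  - by apply: le_trans (xgev k i); rewrite ge_min lexx.
  - by rewrite ler_nat ltnW.
have dk : (2 < k %/ L)%N by rewrite leq_divRL.
have := late (k %/ L).-1 (L + k %% L)%N.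
have -> : ((k %/ L).-1 * L + (L + k %% L))%N = k.
  by rewrite addnA -mulSnr prednK -?divn_eq// (ltn_trans _ dk).
rewrite leq_addr mul2n -addnn leq_add2l ltnW ?ltn_pmod// => /(_ isT) hk.
apply: (@le_trans _ _ (delta * ((k %/ L).-1 * L)%:R * total v * (3 * L)%:R)); last first.
  by rewrite ler_wpM2r.
have ha : a <= delta * total v by rewrite ge_min lexx orbT.
rewrite (mulrAC delta) -[leRHS]mulrA -[X in _ <= _ * X]natrM.
apply: ler_pM => //; first exact: ltW.
rewrite ler_nat.
have : (k <= (k %/ L).+1 * L)%N by rewrite ltnW// ltn_ceil.
move/leq_trans; apply; move: dk; case: (k %/ L)%N => [//|q] /= q2; nia.
Qed.

(** * Estimates and precisions *)

(** The means follow the recursion of the estimates fed with the constant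
    observations [theta]; this noiseless recursion is the [theta_seq] over the
    one-point outcome space [unit]. *)
Lemma has_mean_theta_seq (R : realType) (n : nat) (E : nat -> rel 'I_n)
    (theta sigma theta0 : 'I_n -> R) (d : measure_display)
    (T : measurableType d) (P : probability T R) (S : nat -> 'I_n -> T -> R)
    (k : nat) (i : 'I_n) :
  (forall (k : nat) (i : 'I_n), (1 <= k)%N -> has_mean P (S k i) (theta i)) ->
  has_mean P (theta_seq E sigma theta0 S k i)
    (theta_seq E sigma theta0 (fun _ j (_ : unit) => theta j) k i tt).
Proof.
move=> hS; elim: k i => [|k IHk] i; first exact: has_mean_cst.
have step (U : Type) (Z : nat -> 'I_n -> U -> R) :
    theta_seq E sigma theta0 Z k.+1 i = fun w => (tau_seq E sigma k.+1 i)^-1 *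
      (\sum_j weight_matrix R (E k) i j * tau_seq E sigma k j *
         theta_seq E sigma theta0 Z k j w + precision sigma i * Z k.+1 i w).
  by apply/funext => w /=; rewrite mulrC (mulrC (Z _ _ _)).
rewrite !step; apply: has_meanZ; apply: has_meanD.
  by apply: has_mean_sum => j; exact: has_meanZ.
by apply: has_meanZ; exact: hS.
Qed.

Lemma precision_gt0 (R : realType) (n : nat) (sigma : 'I_n -> R) (i : 'I_n) :
  (forall i, 0 < sigma i) -> 0 < precision sigma i.
Proof. by move=> s0; rewrite divr_gt0// exprn_gt0. Qed.

Lemma tau_seq_linear_growth (R : realType) (n : nat) (sigma : 'I_n -> R)
    (E : nat -> rel 'I_n) (B : nat) (i : 'I_n) :
  (forall i, 0 < sigma i) -> B_strongly_connected E B ->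
  exists2 c, 0 < c & forall k, c * k%:R <= tau_seq E sigma k i.
Proof.
move=> s0 hE.
have [|j|j|c c0 hc] := @affine_linear_growth R n E B
    (fun k => \col_j tau_seq E sigma k j) (\col_j precision sigma j) i hE.
- by move=> k; apply/matrixP => j l; rewrite !mxE; congr (_ + _);
    apply: eq_bigr => h _; congr (_ * _); rewrite mxE.
- by rewrite mxE precision_gt0.
- by rewrite !mxE.
by exists c => // k; have := hc k; rewrite mxE.
Qed.

(** [theta_star] is the precision-weighted average of the [theta i]. *)
Lemma theta_star_balance (R : realType) (n : nat) (theta sigma : 'I_n -> R) :
  (0 < n)%N -> (forall i, 0 < sigma i) ->
  \sum_i precision sigma i * (theta i - theta_star theta sigma) = 0.
Proof.
move=> n0 s0; under eq_bigr do rewrite mulrBr.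
rewrite sumrB -mulr_suml /theta_star.
rewrite [X in _ - X]mulrC divfK; last first.
  rewrite gt_eqF// (bigD1 (Ordinal n0))//= ltr_pwDl ?divr_gt0 ?exprn_gt0//.
  by apply: sumr_ge0 => j _; rewrite divr_ge0 ?exprn_ge0 ?ltW.
by apply/eqP; rewrite subr_eq0; apply/eqP/eq_bigr => j _; rewrite /precision div1r mulrC.
Qed.

(** [tau_k^i (mu_k^i - theta_star)] is bounded uniformly in [k] and [i], where
    [mu] is the noiseless estimate. *)
Lemma weighted_error_bounded (R : realType) (n : nat)
    (theta sigma theta0 : 'I_n -> R) (E : nat -> rel 'I_n) (B : nat) :
  (0 < n)%N -> (forall i, 0 < sigma i) -> B_strongly_connected E B ->
  exists C, forall k i, `|tau_seq E sigma k i *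
    (theta_seq E sigma theta0 (fun _ j (_ : unit) => theta j) k i tt
     - theta_star theta sigma)| <= C.
Proof.
move=> n0 s0 hE; set ts := theta_star _ _.
pose th k i := theta_seq E sigma theta0 (fun _ j (_ : unit) => theta j) k i tt.
pose z k : 'cV[R]_n := \col_i (tau_seq E sigma k i * (th k i - ts)).
pose v : 'cV[R]_n := \col_i (precision sigma i * (theta i - ts)).
have zS k : z k.+1 = weight_matrix R (E k) *m z k + v.
  apply/matrixP => i l; rewrite !mxE.
  have [c c0 hc] := tau_seq_linear_growth i s0 hE.
  have tau_neq0 : tau_seq E sigma k.+1 i != 0.
    by rewrite gt_eqF// (lt_le_trans _ (hc k.+1))// mulr_gt0.
  have -> : tau_seq E sigma k.+1 i * (th k.+1 i - ts) =
      \sum_j weight_matrix R (E k) i j * tau_seq E sigma k j * th k j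
      + theta i * precision sigma i
      - (\sum_j weight_matrix R (E k) i j * tau_seq E sigma k j
         + precision sigma i) * ts.
    by rewrite mulrBr mulrC [in LHS]/th /= divfK.
  have -> : \sum_j weight_matrix R (E k) i j * z k j l =
      \sum_j weight_matrix R (E k) i j * tau_seq E sigma k j * th k j -
      (\sum_j weight_matrix R (E k) i j * tau_seq E sigma k j) * ts.
    rewrite mulr_suml -sumrB; apply: eq_bigr => j _.
    by rewrite [z k j l]mxE mulrBr mulrBr !mulrA.
  by ring.
have v0 : total v = 0.
  rewrite /total -[RHS](theta_star_balance theta n0 s0).
  by apply: eq_bigr => i _; rewrite mxE.
have [C hC] := affine_bounded hE zS v0.
exists C => k i; apply: le_trans (hC k).
by have := le_l1_norm (z k) i; rewrite mxE.
Qed.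

Theorem lemma4 (R : realType) (n : nat) (n_ge1 : (1 <= n)%N)
    (theta sigma theta0 : 'I_n -> R) (sigma_gt0 : forall i : 'I_n, 0 < sigma i)
    (E : nat -> rel 'I_n) (B : nat) (hE : B_strongly_connected E B) :
  exists K : R,
    forall (d : measure_display) (T : measurableType d) (P : probability T R)
      (S : nat -> 'I_n -> {RV P >-> R}),
    (forall (k : nat) (i : 'I_n), (1 <= k)%N ->
       has_normal_law (S k i) (theta i) (sigma i)) ->
    (forall i : 'I_n,
       (fun k : nat => 'E_P[theta_seq E sigma theta0 S k i]%E) @ \oo
         --> (theta_star theta sigma)%:E) /\
    (forall (k : nat) (i : 'I_n), (1 <= k)%N ->
       (`| 'E_P[theta_seq E sigma theta0 S k i] - (theta_star theta sigma)%:E |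
          <= (K / k%:R)%:E)%E).
Proof.
have [C hC] := weighted_error_bounded theta theta0 n_ge1 sigma_gt0 hE.
have /fin_all_exists2[c c_gt0 hc] := fun i => tau_seq_linear_growth i sigma_gt0 hE.
have C_ge0 : 0 <= C by exact: le_trans (hC 0%N (Ordinal n_ge1)).
pose K := \sum_i C / c i; exists K => d T P S hS.
pose th k i := theta_seq E sigma theta0 (fun _ j (_ : unit) => theta j) k i tt.
have ETh k i : ('E_P[theta_seq E sigma theta0 S k i] = (th k i)%:E)%E.
  rewrite unlock; apply: (has_mean_theta_seq E sigma theta0 k i _).2 => {}k {}i k1.
  exact: has_normal_law_mean (sigma_gt0 i) (hS k i k1).
have rate k i : (1 <= k)%N -> `|th k i - theta_star theta sigma| <= K / k%:R.
  move=> k1; have k0 : 0 < k%:R :> R by rewrite ltr0n.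
  have ck0 : 0 < c i * k%:R by rewrite mulr_gt0.
  have tau0 : 0 < tau_seq E sigma k i by exact: lt_le_trans (hc i k).
  apply: (@le_trans _ _ (C / (c i * k%:R))).
    rewrite ler_pdivlMr// mulrC; apply: le_trans (hC k i).
    by rewrite normrM (gtr0_norm tau0) ler_wpM2r.
  rewrite invfM mulrA ler_pM2r ?invr_gt0// /K (bigD1 i)//= lerDl.
  by apply: sumr_ge0 => j _; rewrite divr_ge0// ltW.
split=> [i|k i k1]; last by rewrite ETh -EFinB lee_fin; exact: rate.
under eq_fun do rewrite ETh.
apply: cvg_EFin; first by apply: nearW.
apply/cvgrPdist_le => e e0; near=> k.
have k1 : (1 <= k)%N by near: k; exact: nbhs_infty_ge.
have k0 : 0 < k%:R :> R by rewrite ltr0n.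
rewrite distrC /=; apply: le_trans (rate k i k1) _.
rewrite ler_pdivrMr// -ler_pdivrMl//.
near: k; exact: nbhs_infty_ger.
Unshelve. all: by end_near. Qed.
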